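(* (1) Let $F\colon Y\to Y$ be given by $$F([v,u])=[\psi_1(v)+\psi_2(u)+v_0,\ \varphi(u)+u_0],\qquad(\ast)$$ where $v_0\in V'$, $u_0\in V$, $\psi_1\colon V'\to V'$ and $\varphi\colon V\to V$ are linear bijections, $\psi_2\colon V\to V'$, and a) $\psi_2(u)=\eta(\varphi(u),u_0)$ for every $u\in V$, and b) $\eta(\varphi(u_1),\varphi(u_2))=\psi_1(\eta(u_1,u_2))$ for all $u_1,u_2\in V$. Then $F$ preserves the relation $\approx$, and $\varrho(F(p_1),F(p_2))=\psi_1(\varrho(p_1,p_2))$ for any pair $p_1,p_2$ of points of $\mathfrak{A}$. (2) Conversely, if condition (D) of the context is valid, then each linear (affine) automorphism of $\mathfrak{A}$ (i.e. each composition of a translation with a linear bijection of $Y$) that preserves $\approx$ is of the form $(\ast)$ with $v_0,u_0,\psi_1,\psi_2,\varphi$ as in (1), satisfying a) and b).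
   Context: Let $K$ be a commutative field with $\mathrm{char}(K)\neq 2$; let $V,V'$ be vector spaces over $K$ with zero vectors $\theta$ and $\mathbf{0}$, $\dim V'<\infty$; let $\eta\colon V\times V\to V'$ be an alternating bilinear map ($\eta(u,u)=\mathbf{0}$ for all $u$) that is nondegenerate (for each $u_1\ne\theta$ there is $u_2$ with $\eta(u_1,u_2)\neq\mathbf{0}$). Let $Y=V'\oplus V$, with vectors written $[v,u]$, $v\in V'$, $u\in V$, and let $\mathfrak{A}$ be the affine space over $Y$ (points are the vectors of $Y$, lines are the cosets of 1-dimensional subspaces). The semiform is $\varrho([v_1,u_1],[v_2,u_2])=\eta(u_1,u_2)-(v_1-v_2)$. Write $p_1\approx p_2$ iff $\varrho(p_1,p_2)=\mathbf{0}$. A map $F$ preserves $\approx$ if $p_1\approx p_2\iff F(p_1)\approx F(p_2)$. Let $\mathcal{G}$ be the class of lines $L$ of $\mathfrak{A}$ such that $p_1\approx p_2$ for all $p_1,p_2\in L$. Let $D$ be the set of (nonzero) $q\in Y$ such that no line in $\mathcal{G}$ has direction $q$ (the line $p+\langle q\rangle$ has direction $q$). Condition (D): the set of directions of $V'\times\{\theta\}$ can be characterized in terms of the projective geometry of the horizon of $\mathfrak{A}$ (the projective space of 1-dimensional subspaces of $Y$) with the set of directions of $D$ distinguished; that is, every semilinear bijection $f$ of $Y$ which preserves $D$ (i.e. $f(D)=D$) maps $V'\times\{\theta\}$ onto itself. *)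

(* Defs.v *)
From HB Require Import structures.
From mathcomp Require Import all_boot all_algebra sesquilinear.
From mathcomp Require Import classical_sets.

Set Implicit Arguments.
Unset Strict Implicit.
Unset Printing Implicit Defensive.

Import GRing.Theory.
Local Open Scope classical_set_scope.
Local Open Scope ring_scope.

Section AffineSpace.
Variables (K : fieldType) (Y : lmodType K).
Implicit Types (p q : Y) (L : set Y).

(* The coset p + <q>; it is an affine line only when q is nonzero. *)
Definition coset_line p q : set Y := [set x | exists a : K, x = p + a *: q].

Definition has_direction L q : Prop :=
  q != 0 /\ exists p, L = coset_line p q.

Definition is_line L : Prop := exists q, has_direction L q.

Definition semilinear_bijection (f : Y -> Y) : Prop :=
  bijective f /\
  exists sigma : {rmorphism K -> K},
    bijective sigma /\ linear_for (sigma \; *:%R) f.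

Definition affine_automorphism (F : Y -> Y) : Prop :=
  exists (g : {linear Y -> Y}) (t : Y),
    bijective g /\ forall p, F p = g p + t.

End AffineSpace.

Section Semiform.
Variables (K : fieldType) (V : lmodType K) (V' : vectType K).
Variable eta : {bilinear V -> V -> V'}.

Definition alternating_map : Prop := forall u, eta u u = 0.

Definition nondegenerate_map : Prop :=
  forall u1, u1 != 0 -> exists u2, eta u1 u2 != 0.

Notation Y := (V' * V)%type.

Definition semiform (p1 p2 : Y) : V' := eta p1.2 p2.2 - (p1.1 - p2.1).

Definition adjacent (p1 p2 : Y) : Prop := semiform p1 p2 = 0.

Definition preserves_adjacency (F : Y -> Y) : Prop :=
  forall p1 p2, adjacent p1 p2 <-> adjacent (F p1) (F p2).

Definition isotropic_line (L : set Y) : Prop :=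
  is_line L /\ forall p1 p2, L p1 -> L p2 -> adjacent p1 p2.

Definition nonisotropic_dirs : set Y :=
  [set q | q != 0 /\ forall L, isotropic_line L -> ~ has_direction L q].

Definition vertical : set Y := [set p | p.2 = 0].

Definition condition_D : Prop :=
  forall f : Y -> Y, semilinear_bijection f ->
    f @` nonisotropic_dirs = nonisotropic_dirs ->
    f @` vertical = vertical.

End Semiform.

(* Main.v *)
(* The line through (a, b) with direction (v, u) lies in the class of isotropic
   lines iff eta b u = - v, but only the following invariance is needed: an
   adjacency-preserving F = g + t permutes the isotropic lines, so its linear
   part g preserves the nonisotropic directions, and by condition (D) it
   preserves V' x 0.  Hence g is block triangular with blocks psi1, A, phi.
   Applying F to the adjacent pair (eta u1 u2, u1), (0, u2) gives
     psi1 (eta u1 u2) + A (u1 - u2) =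
       eta (phi u1) (phi u2) + eta (phi (u1 - u2)) u0,
   whose case u2 = 0 is A u1 = eta (phi u1) u0, i.e. a), leaving b). *)
Require Import Defs.
From HB Require Import structures.
From mathcomp Require Import all_boot all_algebra sesquilinear.
From mathcomp Require Import classical_sets.

Set Implicit Arguments.
Unset Strict Implicit.
Unset Printing Implicit Defensive.

Import GRing.Theory.
Local Open Scope ring_scope.

Lemma alternating_skew (K : fieldType) (V : lmodType K) (V' : vectType K)
    (eta : {bilinear V -> V -> V'}) (eta_alt : alternating_map eta) u w :
  eta u w = - eta w u.
Proof.
apply/eqP; rewrite -addr_eq0; apply/eqP.
by have := eta_alt (u + w); rewrite linearDl !linearDr /= !eta_alt addr0 add0r.
Qed.

(** A line of given direction is fixed by a base point, so the quantifier over sets of points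
    becomes one over [p], and adjacency can be transported parameter by parameter. *)
Lemma nonisotropic_dirsP (K : fieldType) (V : lmodType K) (V' : vectType K)
    (eta : {bilinear V -> V -> V'}) q :
  nonisotropic_dirs eta q <->
  q != 0 /\
  ~ exists p, forall a b : K, adjacent eta (p + a *: q) (p + b *: q).
Proof.
split=> -[q0 nq]; split=> //.
  case=> p adj; apply: (nq (coset_line p q)); last by split=> //; exists p.
  split; first by exists q; split=> //; exists p.
  by move=> _ _ [a ->] [b ->].
move=> L [_ adj] [_ [p Lp]]; apply: nq; exists p => a b.
by apply: adj; rewrite Lp; [exists a | exists b].
Qed.

Lemma linear_part_nonisotropic_dirs (K : fieldType) (V : lmodType K)
    (V' : vectType K) (eta : {bilinear V -> V -> V'})
    (g : {linear (V' * V)%type -> (V' * V)%type}) (t : V' * V) :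
  bijective g -> preserves_adjacency eta (fun p => g p + t) ->
  (g @` nonisotropic_dirs eta = nonisotropic_dirs eta)%classic.
Proof.
move=> [h gK hK] adjF.
have gD q : nonisotropic_dirs eta (g q) <-> nonisotropic_dirs eta q.
  (* The parameter [a] is kept on passing from direction [q] to direction [g q]. *)
  have shift p a : g (p + a *: q) + t = g p + t + a *: g q.
    by rewrite linearD linearZ addrAC.
  rewrite !nonisotropic_dirsP.
  have -> : (g q != 0) = (q != 0) by rewrite -(can_eq gK q 0) linear0.
  split=> -[q0 nq]; split=> // -[p adj]; apply: nq.
    by exists (g p + t) => a b; rewrite -!shift -adjF.
  (* The base point is the preimage of [p] under [g + t]. *)
  by exists (h (p - t)) => a b; apply/adjF; rewrite !shift hK subrK.
apply/seteqP; split=> [_ [q Dq <-]|q Dq]; first exact/gD.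
by exists (h q); rewrite ?hK //; apply/gD; rewrite hK.
Qed.

Section BlockDecomposition.
Variables (K : fieldType) (V : lmodType K) (V' : vectType K).
Variable g : {linear (V' * V)%type -> (V' * V)%type}.

Definition fst_block (v : V') : V' := (g (v, 0)).1.
Definition snd_block (u : V) : V := (g (0, u)).2.

Lemma fst_block_is_linear : linear fst_block.
Proof.
(* Projections commute with linear combinations by conversion, which exposes the linearity of
   [g]. *)
move=> a v w; rewrite /fst_block -[RHS]/((a *: g (v, 0) + g (w, 0)).1) -linearP.
by congr (g _).1; congr (_, _); rewrite /= scaler0 addr0.
Qed.

Lemma snd_block_is_linear : linear snd_block.
Proof.
move=> a v w; rewrite /snd_block -[RHS]/((a *: g (0, v) + g (0, w)).2) -linearP.
by congr (g _).2; congr (_, _); rewrite /= scaler0 addr0.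
Qed.

HB.instance Definition _ :=
  GRing.isLinear.Build K V' V' *:%R fst_block fst_block_is_linear.
HB.instance Definition _ :=
  GRing.isLinear.Build K V V *:%R snd_block snd_block_is_linear.

Hypotheses (g_bij : bijective g)
  (g_vert : (g @` @vertical K V V' = @vertical K V V')%classic).

Lemma block_vertical v : g (v, 0) = (fst_block v, 0).
Proof.
have : @vertical K V V' (g (v, 0)) by rewrite -g_vert; exists (v, 0).
by rewrite /fst_block; case: (g _) => a b b0; congr (_, _).
Qed.

Lemma block_triangular v u :
  g (v, u) = (fst_block v + (g (0, u)).1, snd_block u).
Proof.
have -> : (v, u) = (v, 0) + (0, u) :> V' * V.
  by congr (_, _); rewrite /= ?addr0 ?add0r.
rewrite linearD block_vertical /snd_block.
by case: (g (0, u)) => a b; congr (_, _); rewrite /= add0r.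
Qed.

Lemma fst_block_bij : bijective fst_block.
Proof.
have [h gK hK] := g_bij; exists (fun v => (h (v, 0)).1) => v /=.
  by rewrite -block_vertical gK.
(* Surjectivity needs the other inclusion of [g_vert]: [(v, 0)] has a preimage that is itself
   vertical. *)
have : @vertical K V V' (v, 0) by [].
rewrite -g_vert => -[[w u] /= wV gw]; rewrite -gw gK /=.
by move: gw; rewrite (wV : u = 0) block_vertical => -[].
Qed.

Lemma snd_block_bij : bijective snd_block.
Proof.
have [h gK hK] := g_bij; have [k _ kK] := fst_block_bij.
exists (fun u => (h (0, u)).2) => u /=.
  (* Since [fst_block] is onto, the first coordinate can be chosen to cancel the off-diagonal block
     at [u]. *)
  suff -> : (0, snd_block u) = g (k (- (g (0, u)).1), u) by rewrite gK.
  by rewrite block_triangular kK addNr.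
have := hK (0, u); case: (h _) => w x; rewrite block_triangular /=.
by case.
Qed.

End BlockDecomposition.

Theorem proposition2p27 (K : fieldType) (charK : 2%N \notin [pchar K])
    (V : lmodType K) (V' : vectType K) (eta : {bilinear V -> V -> V'})
    (eta_alt : alternating_map eta) (eta_nondeg : nondegenerate_map eta) :
  (forall (v0 : V') (u0 : V) (psi1 : {linear V' -> V'}) (psi2 : V -> V')
          (phi : {linear V -> V}) (F : V' * V -> V' * V),
     bijective psi1 -> bijective phi ->
     (forall v u, F (v, u) = (psi1 v + psi2 u + v0, phi u + u0)) ->
     (forall u, psi2 u = eta (phi u) u0) ->
     (forall u1 u2, eta (phi u1) (phi u2) = psi1 (eta u1 u2)) ->
     preserves_adjacency eta F /\
     (forall p1 p2, semiform eta (F p1) (F p2) = psi1 (semiform eta p1 p2)))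
  /\
  (condition_D eta ->
   forall F : V' * V -> V' * V,
     affine_automorphism F -> preserves_adjacency eta F ->
     exists (v0 : V') (u0 : V) (psi1 : {linear V' -> V'}) (psi2 : V -> V')
            (phi : {linear V -> V}),
       bijective psi1 /\ bijective phi /\
       (forall v u, F (v, u) = (psi1 v + psi2 u + v0, phi u + u0)) /\
       (forall u, psi2 u = eta (phi u) u0) /\
       (forall u1 u2, eta (phi u1) (phi u2) = psi1 (eta u1 u2))).
Proof.
have skew := alternating_skew eta_alt.
split=> [v0 u0 psi1 psi2 phi F psi1_bij phi_bij FE psi2E phiE | condD F].
  have rhoF p1 p2 : semiform eta (F p1) (F p2) = psi1 (semiform eta p1 p2).
    case: p1 p2 => [v1 u1] [v2 u2]; rewrite /semiform !FE /= !psi2E.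
    (* By skew symmetry the cross terms with [u0] amount to [psi2 u1 - psi2 u2], which is exactly
       what the difference of first coordinates subtracts; [v0] drops out of that difference. *)
    rewrite linearDl !linearDr /= eta_alt addr0 phiE !(linearB psi1) /=.
    have subDD (x y z x' y' : V') :
        x + y + z - (x' + y' + z) = (y - y') + (x - x').
      by rewrite opprD addrACA subrr addr0 opprD addrACA addrC.
    by rewrite (skew u0) subDD -(addrA (psi1 _)) addrKA.
  split=> // p1 p2; rewrite /adjacent rhoF.
  split=> [->|]; first exact: linear0.
  by move=> e; apply: (bij_inj psi1_bij); rewrite e linear0.
move=> [g [[v0 u0] [g_bij FE]]] adjF.
have g_vert : (g @` @vertical K V V' = @vertical K V V')%classic.
  apply: condD.
    (* A linear map is semilinear over the identity automorphism of [K]. *)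
    split=> //; exists idfun; split; first by exists idfun.
    by move=> a p q; rewrite linearP.
  apply: (linear_part_nonisotropic_dirs (t := (v0, u0)) g_bij) => p1 p2.
  by rewrite -!FE; exact: adjF.
pose A u := (g (0, u)).1.
have FE' v u : F (v, u) = (fst_block g v + A u + v0, snd_block g u + u0).
  by rewrite FE (block_triangular g_vert).
have key u1 u2 : fst_block g (eta u1 u2) + A u1 - A u2 =
    eta (snd_block g u1 + u0) (snd_block g u2 + u0).
  have : adjacent eta (eta u1 u2, u1) (0, u2).
    by rewrite /adjacent /semiform /= subr0 subrr.
  move/adjF; rewrite !FE' /adjacent /semiform /= linear0 add0r => /eqP.
  rewrite subr_eq0 => /eqP ->.
  by rewrite opprD addrACA subrr addr0.
have A0 : A 0 = 0 by rewrite /A linear0.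
have AE u : A u = eta (snd_block g u) u0.
  have := key u 0.
  by rewrite linear0r !linear0 add0r A0 subr0 add0r linearDl /= eta_alt addr0.
exists v0, u0, (fst_block g), A, (snd_block g).
split; first exact: fst_block_bij.
split; first exact: snd_block_bij.
split=> //; split=> // u1 u2.
(* With a) inserted, both sides carry the same two cross terms with [u0], up to skew symmetry;
   cancelling them leaves b). *)
have := key u1 u2; rewrite !AE linearDl !linearDr /= eta_alt addr0.
by rewrite (skew u0) => /addIr/addIr ->.
Qed.
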